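(* Consider a cake-division instance with a finite set $\mathcal{N}$ of agents, subjective density functions $u_i:[0,1]\to\mathbb{R}_{\ge0}$ ($i\in\mathcal{N}$) that are strictly positive and Lipschitz continuous, and heterogeneous market density functions $v_i$ ($i\in\mathcal{N}$). Then for every $\epsilon>0$ there exists an allocation of the cake that is $\epsilon$-Pareto optimal with respect to the subjective utilities and equitable with respect to the market values.
   Context: The cake is the interval $[0,1]$; a piece is a Borel subset of $[0,1]$. A density function is an integrable $f:[0,1]\to\mathbb{R}_{\ge0}$, and the value of a piece $X$ is $f(X)=\int_X f(x)\,dx$. Heterogeneous market values means each agent $i$ has her own (possibly different) market density function $v_i$. An allocation $A=(A_i)_{i\in\mathcal{N}}$ is a partition of $[0,1]$ into pieces, pairwise disjoint up to overlaps of Lebesgue measure zero, with $A_i$ given to agent $i$. A function $f:[0,1]\to\mathbb{R}_{\ge0}$ is $K$-Lipschitz if $|f(x)-f(y)|\le K|x-y|$ for all $x,y\in[0,1]$, and Lipschitz continuous if it is $K$-Lipschitz for some $K$. $A$ is $\epsilon$-Pareto optimal with respect to $(u_i)_{i\in\mathcal{N}}$ if there is no allocation $A'$ with $u_i(A'_i)\ge u_i(A_i)+\epsilon$ for all $i\in\mathcal{N}$. $A$ is equitable (EQ) with respect to the market values if $v_i(A_i)=v_{i'}(A_{i'})$ for all $i,i'\in\mathcal{N}$. *)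

(* Defs.v *)
From HB Require Import structures.
From mathcomp Require Import all_boot all_order all_algebra.
From mathcomp Require Import all_classical all_reals all_analysis.

Set Implicit Arguments.
Unset Strict Implicit.
Unset Printing Implicit Defensive.

Import Order.TTheory GRing.Theory Num.Theory.
Import numFieldNormedType.Exports.

Local Open Scope classical_set_scope.
Local Open Scope ring_scope.

Definition cake (R : realType) : set R := `[0, 1].
Arguments cake {R}.

(* [measurableTypeR R] carries the Borel sigma-algebra. *)
Definition piece (R : realType) (X : set R) : Prop :=
  @measurable _ (measurableTypeR R) X /\ X `<=` cake.

(* Densities are functions on the whole line of which only the restriction to
   the cake matters.  The completed measure is used so that densities range over
   all Lebesgue-integrable functions: [lebesgue_measure] lives on the Borel
   sigma-algebra, and integrability with respect to it would require Borel
   measurability.  Both measures coincide on Borel sets. *)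
Definition density (R : realType) (f : R -> R) : Prop :=
  (forall x, cake x -> 0 <= f x) /\
  (@completed_lebesgue_measure R).-integrable cake (EFin \o f).

Definition value (R : realType) (f : R -> R) (X : set R) : R :=
  \int[@completed_lebesgue_measure R]_(x in X) f x.

Definition lipschitz_density (R : realType) (f : R -> R) : Prop :=
  exists K : R, K.-lipschitz_cake (f : R^o -> R^o).

Definition allocation (R : realType) (N : finType) (A : N -> set R) : Prop :=
  [/\ forall i, piece (A i),
      \bigcup_i A i = cake
    & forall i j, i != j -> lebesgue_measure (A i `&` A j) = 0%E].

Definition eps_pareto_optimal (R : realType) (N : finType)
    (u : N -> R -> R) (eps : R) (A : N -> set R) : Prop :=
  ~ exists A' : N -> set R,
      allocation A' /\ forall i, value (u i) (A i) + eps <= value (u i) (A' i).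

Definition equitable (R : realType) (N : finType)
    (v : N -> R -> R) (A : N -> set R) : Prop :=
  forall i j, value (v i) (A i) = value (v j) (A j).

(* Main.v *)
Require Import Defs.
From HB Require Import structures.
From mathcomp Require Import all_boot all_order all_algebra.
From mathcomp Require Import all_classical all_reals all_analysis.
From mathcomp Require Import measurable_realfun ring lra.

Set Implicit Arguments.
Unset Strict Implicit.
Unset Printing Implicit Defensive.

Import Order.TTheory GRing.Theory Num.Theory.
Import numFieldNormedType.Exports.

Local Open Scope classical_set_scope.
Local Open Scope ring_scope.

(* Fix potentials [b_i], close to [ln u_i], such that for distinct [i], [j] the
   difference [b_i - b_j] spends little length near any given value.  For log
   weights [p], the share of [i] is the set where [p_i + b_i] is maximal.  Shares
   overlap in null sets, vary continuously with [p], and nearly maximize the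
   welfare weighted by [e^(p_i)], so they are eps-Pareto optimal for every [p].

   It remains to equalize the market values.  No fixed point theorem is needed,
   because goods are gross substitutes: lowering the weights of a set of agents
   only shrinks their shares and enlarges the others'.  If the market densities
   are bounded below by a positive constant, take [p] maximizing the least value
   and, among those, having fewest minimizers; if some agent were above the
   minimum, lowering all such agents by a suitable amount would keep them above
   it and strictly help a minimizer.  The general case follows by adding a
   constant [eta] to the densities and letting [eta] tend to 0 by compactness. *)

(** * Values of pieces *)

Section values.
Context {R : realType}.
Implicit Types (f g : R -> R) (X Y Z : set R).
Local Notation mu := (@completed_lebesgue_measure R).
Local Notation lambda := (@lebesgue_measure R).

(** Lebesgue measure of a piece as a real number, written as a value so that the lemmas on values
    apply to it. *)
Definition len X : R := value (fun=> 1) X.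

Lemma piece_completed X : piece X -> (wlength idfun)^*%mu.-cara.-measurable X.
Proof. by move=> [mX _]; exact: (sub_caratheodory _ mX). Qed.

Lemma piece_cake : piece (@cake R).
Proof. by split => //; exact: measurable_itv. Qed.

Lemma piece0 : piece (@set0 R).
Proof. by split; [exact: measurable0|exact: sub0set]. Qed.

Lemma pieceI X Y : piece X -> piece Y -> piece (X `&` Y).
Proof.
move=> [mX Xc] [mY _]; split; first exact: measurableI.
by move=> x [/Xc].
Qed.

Lemma pieceU X Y : piece X -> piece Y -> piece (X `|` Y).
Proof.
move=> [mX Xc] [mY Yc]; split; first exact: measurableU.
by move=> x [/Xc|/Yc].
Qed.

Lemma pieceD X Y : piece X -> piece Y -> piece (X `\` Y).
Proof.
move=> [mX Xc] [mY _]; split; first exact: measurableD.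
by move=> x [/Xc].
Qed.

Lemma density_integrable f X : density f -> piece X ->
  mu.-integrable X (EFin \o f).
Proof.
move=> [_ fi] pX; apply: integrableS fi => //.
- exact/piece_completed/piece_cake.
- exact: piece_completed.
- exact: pX.2.
Qed.

Lemma mu_cake : mu (@cake R) = 1%E.
Proof.
have -> : mu (@cake R) = lambda cake by [].
by rewrite lebesgue_measure_itv/= lte_fin ltr01 sube0.
Qed.

Lemma density_cst (c : R) : 0 <= c -> density (fun _ : R => c).
Proof.
move=> c0; split => //.
apply/integrableP; split; first exact: measurable_cst.
rewrite integral_cst/=; last exact/piece_completed/piece_cake.
by rewrite mu_cake mule1 ltry.
Qed.

Lemma density_add f g : density f -> density g ->
  density (fun x => f x + g x).
Proof.
move=> [f0 fi] [g0 gi]; split=> [x cx|]; first by rewrite addr_ge0 ?f0 ?g0.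
have := integrableD (piece_completed piece_cake) fi gi.
by congr (_.-integrable _ _); apply/funext => x /=; rewrite EFinD.
Qed.

Lemma le_mu X Y : piece X -> piece Y -> X `<=` Y -> (mu X <= mu Y)%E.
Proof.
by move=> pX pY; apply: (@le_measure _ _ _ mu); rewrite inE; exact: piece_completed.
Qed.

Lemma lenE X : piece X -> (len X)%:E = mu X.
Proof.
move=> pX; rewrite /len /value Rintegral_cst; last exact: piece_completed.
rewrite mul1r fineK// ge0_fin_numE//.
by rewrite (le_lt_trans (le_mu pX piece_cake pX.2))// mu_cake ltry.
Qed.

Lemma value_cst (c : R) X : piece X -> value (fun=> c) X = c * len X.
Proof.
move=> pX.
rewrite /len /value !Rintegral_cst; [|exact: piece_completed..].
by rewrite mul1r.
Qed.

Lemma value_add f g X : density f -> density g -> piece X ->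
  value (fun x => f x + g x) X = value f X + value g X.
Proof.
move=> df dg pX.
by rewrite /value RintegralD//; [exact: piece_completed|
  exact: density_integrable..].
Qed.

Lemma value_ge0 f X : density f -> piece X -> 0 <= value f X.
Proof. by move=> [f0 _] [_ Xc]; apply: Rintegral_ge0 => x /Xc/f0. Qed.

Lemma value_setU f X Y : density f -> piece X -> piece Y -> X `&` Y = set0 ->
  value f (X `|` Y) = value f X + value f Y.
Proof.
move=> df pX pY XY; apply: Rintegral_setU.
- exact: piece_completed.
- exact: piece_completed.
- by apply: density_integrable => //; exact: pieceU.
- by apply/disj_setPS; rewrite XY.
Qed.

Lemma value_setID f X Y : density f -> piece X -> piece Y ->
  value f X = value f (X `&` Y) + value f (X `\` Y).
Proof.
move=> df pX pY; rewrite -value_setU//.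
- by rewrite setUIDK.
- exact: pieceI.
- exact: pieceD.
- by apply/seteqP; split => x // [[_ ?] []].
Qed.

Lemma value_subset f X Y : density f -> piece X -> piece Y -> X `<=` Y ->
  value f X <= value f Y.
Proof.
move=> df pX pY XY; rewrite (value_setID df pY pX) (setIidr XY) lerDl.
by rewrite value_ge0//; exact: pieceD.
Qed.

Lemma ler_value f g X : density f -> density g -> piece X ->
  (forall x, X x -> f x <= g x) -> value f X <= value g X.
Proof.
move=> df dg pX fg; apply: (@le_Rintegral _ _ _ mu X) => //.
- exact: piece_completed.
- exact: density_integrable.
- exact: density_integrable.
Qed.

(** Absolute continuity of the integral, applied to the extension of [f] by 0 outside the cake. *)
Lemma value_small f (e : R) : density f -> 0 < e ->
  exists2 d : R, 0 < d & forall X, piece X -> len X < d -> value f X < e.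
Proof.
move=> df e0; have mcake := piece_completed piece_cake.
have fi : mu.-integrable setT (EFin \o (f \_ cake)).
  by rewrite -restrict_EFin -integrable_mkcond//; exact: df.2.
have [d [d0 dP]] := integral_normr_continuous fi e0.
exists d => // X pX Xd; apply: le_lt_trans (dP X (piece_completed pX) _).
  rewrite le_eqVlt; apply/orP; left; apply/eqP.
  apply: eq_Rintegral => x /[!inE] /pX.2 cx.
  by rewrite patchE mem_set// ger0_norm//; exact: df.1.
by have := Xd; rewrite -lte_fin lenE.
Qed.

Lemma value_null f X : density f -> piece X -> len X = 0 -> value f X = 0.
Proof.
move=> df pX X0; apply/eqP; rewrite eq_le value_ge0// andbT.
apply/ler_addgt0Pr => e e0; have [d d0 dP] := value_small df e0.
by rewrite add0r ltW// dP// X0.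
Qed.

Lemma len_ge0 X : piece X -> 0 <= len X.
Proof. by apply: value_ge0; exact: density_cst. Qed.

Lemma len_le1 X : piece X -> len X <= 1.
Proof.
by move=> pX; rewrite -lee_fin lenE// -mu_cake le_mu//; [exact: piece_cake|exact: pX.2].
Qed.

Lemma len_interval X (a b : R) : piece X -> a <= b -> X `<=` `[a, b] ->
  len X <= b - a.
Proof.
move=> pX ab Xab; rewrite -lee_fin lenE//.
have -> : (b - a)%:E = mu `[a, b].
  have -> : mu `[a, b] = lambda `[a, b] by [].
  rewrite lebesgue_measure_itv/= lte_fin; case: ltP => // ba.
  by rewrite (@le_anti _ _ a b) ?subrr ?ab.
apply: (@le_measure _ _ _ mu); rewrite ?inE; [exact: piece_completed| |by []].
apply: sub_caratheodory; exact: measurable_itv.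
Qed.

Lemma ler_value_bigcup f X (N : finType) (A : N -> set R) :
  density f -> piece X -> (forall i, piece (A i)) -> X `<=` \bigcup_i A i ->
  value f X <= \sum_i value f (A i).
Proof.
move=> df pX pA XA.
have {}XA x : X x -> exists2 i, i \in index_enum N & A i x.
  by move=> /XA[i _ Aix]; exists i; rewrite ?mem_index_enum.
elim: (index_enum N) X pX XA => [|i s IH] X pX XA.
  suff -> : X = set0 by rewrite big_nil /value Rintegral_set0.
  by apply/seteqP; split => // x /XA[].
rewrite big_cons (value_setID df pX (pA i)) lerD//.
  by apply: value_subset => //; exact: pieceI.
apply: IH => [|x [/XA[j]]]; first exact: pieceD.
by rewrite inE => /predU1P[->//|js Ajx _]; exists j.
Qed.

(** The union bound gives one inequality; for the other, removing [A i] from [X] takes only a null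
    set from each later [A j]. *)
Lemma value_allocation f X (N : finType) (A : N -> set R) :
  density f -> piece X -> allocation A ->
  value f X = \sum_i value f (X `&` A i).
Proof.
move=> df pX [pA UA A0]; apply/eqP; rewrite eq_le; apply/andP; split.
  apply: ler_value_bigcup => // [i|x Xx]; first exact: pieceI.
  by have := pX.2 x Xx; rewrite -UA => -[i _ Aix]; exists i.
elim: (index_enum N) (index_enum_uniq N) X pX => [|i s IH] /= us X pX.
  by rewrite big_nil value_ge0.
case/andP: us => si us; rewrite big_cons (value_setID df pX (pA i)) lerD2l.
apply: le_trans (IH us _ (pieceD pX (pA i))); rewrite big_seq [leRHS]big_seq.
apply: ler_sum => j js; rewrite (value_setID df (pieceI pX (pA j)) (pA i)).
rewrite value_null ?add0r//.
- apply: value_subset => //.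
  + exact/pieceD/pA/pieceI.
  + exact/pieceI/pA/pieceD.
  + by move=> x [[]].
- exact/pieceI/pA/pieceI.
- apply/eqP; rewrite eq_le len_ge0 ?andbT; last exact/pieceI/pA/pieceI.
  apply: (@le_trans _ _ (len (A j `&` A i))).
    apply: value_subset; [exact: density_cst| | |by move=> x [[]]].
    + exact/pieceI/pA/pieceI.
    + exact: pieceI.
  have ji : j != i by apply: contraNneq si => <-.
  by rewrite -lee_fin lenE; [rewrite [X in (X <= _)%E](A0 _ _ ji)|exact: pieceI].
Qed.

End values.

(** * Shares defined by potentials *)

Section shares.
Context {R : realType} {N : finType}.
Implicit Types (b : N -> R -> R) (p q : N -> R) (f : R -> R) (i j : N).

(** A tied point belongs to all agents who tie there; an allocation permits null overlaps. *)
Definition share b p i : set R :=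
  [set x | cake x /\ forall j, p j + b j x <= p i + b i x].

Definition strip b i j (s d : R) : set R :=
  [set x | cake x /\ `|b i x - b j x - s| <= d].

(* The strip condition makes the distribution function of [b i - b j] Lipschitz:
   ties are negligible and shares vary continuously with [p]. *)
Definition thin_ties b (B C : R) : Prop :=
  [/\ 0 <= C, forall p i, piece (share b p i),
      forall i j s d, piece (strip b i j s d),
      forall i j s d, i != j -> 0 <= d -> len (strip b i j s d) <= C * d
    & forall i j x, cake x -> b i x - b j x <= B].

Context (b : N -> R -> R) (B C : R).
Hypothesis bBC : thin_ties b B C.

Let C0 : 0 <= C. Proof. by case: bBC. Qed.
Let pshare p i : piece (share b p i). Proof. by case: bBC. Qed.
Let pstrip i j s d : piece (strip b i j s d). Proof. by case: bBC. Qed.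

Lemma share_cover p : (0 < #|N|)%N -> \bigcup_i share b p i = cake.
Proof.
move=> /card_gt0P[i0 _]; apply/seteqP; split=> [x [i _ []]//|x cx].
have [i _ imax] := Order.TotalTheory.arg_maxP (fun i => p i + b i x) (isT : xpredT i0).
by exists i => //; split => // j; exact: imax.
Qed.

(** A tie lies in the strip of half-width 0 around [p j - p i]. *)
Lemma len_shareI p i j : i != j -> len (share b p i `&` share b p j) = 0.
Proof.
move=> ij; apply/eqP; rewrite eq_le len_ge0 ?andbT; last exact: pieceI.
have [_ _ _ /(_ i j (p j - p i) 0 ij (lexx _)) + _] := bBC.
rewrite mulr0; apply: le_trans; apply: value_subset => //.
- exact: density_cst.
- exact: pieceI.
- move=> x [[cx /(_ j) xi] [_ /(_ i) xj]]; split => //.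
  by rewrite ler_norml; apply/andP; split; lra.
Qed.

Lemma share_allocation p : (0 < #|N|)%N -> allocation (share b p).
Proof.
move=> N0; split; [exact: pshare|exact: share_cover|move=> i j ij].
by have := congr1 EFin (len_shareI p ij); rewrite lenE//; exact: pieceI.
Qed.

(** The potential of [j] nowhere exceeds that of [i] by more than [B], so it cannot make up for such
    a gap in weights. *)
Lemma share_far p i j : p j + B < p i -> share b p j = set0.
Proof.
move=> pji; apply/seteqP; split => // x [cx /(_ i) xj].
have [_ _ _ _ /(_ j i x cx)] := bBC; lra.
Qed.

Lemma share_shift p c : share b (fun i => p i + c) = share b p.
Proof.
apply/funext => i; apply/seteqP; split=> x [cx xi]; split=> // j;
have := xi j; lra.
Qed.

(** A point that [i] loses to [j] was nearly tied: [b i - b j] is there within [2 * d] of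
    [p j - p i]. *)
Lemma len_shareD p q i d : 0 <= d -> (forall j, `|p j - q j| <= d) ->
  len (share b p i `\` share b q i) <= #|N|%:R * (C * (2 * d)).
Proof.
move=> d0 pq; pose S j := if j == i then set0 else strip b i j (p j - p i) (2 * d).
have pS j : piece (S j) by rewrite /S; case: ifP => // _; exact: piece0.
apply: (@le_trans _ _ (\sum_j len (S j))); last first.
  rewrite -sum1_card natr_sum mulr_suml; apply: ler_sum => j _.
  rewrite mul1r /S; case: eqVneq => [_|ji].
    by rewrite /len /value Rintegral_set0 !mulr_ge0.
  have [_ _ _ + _] := bBC; apply; first by rewrite eq_sym.
  by rewrite mulr_ge0.
apply: ler_value_bigcup; [exact: density_cst|exact: pieceD|exact: pS|].
move=> x [[cx xi] xni].
have [j xj] : exists j, q i + b i x < q j + b j x.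
  apply: contrapT => /forallNP h; apply: xni; split => // j.
  by rewrite leNgt; apply/negP/h.
exists j => //; rewrite /S; case: eqVneq xj => [->|_ xj]; first by rewrite ltxx.
split=> //; have := xi j; have := pq i; have := pq j.
by rewrite !ler_norml => /andP[? ?] /andP[? ?] ?; apply/andP; split; lra.
Qed.

Lemma value_share_unif f i (e : R) : density f -> 0 < e ->
  exists2 d : R, 0 < d & forall p q, (forall j, `|p j - q j| < d) ->
    `|value f (share b p i) - value f (share b q i)| < e.
Proof.
move=> df e0; have [d d0 dP] := value_small df e0.
(* With the extra 1, [K] is positive and the bound [(K - 1) * (d / K)] on the lost length is
   strictly below [d]. *)
pose K := #|N|%:R * (C * 2) + 1.
have K0 : 0 < K by rewrite ltr_wpDl ?ltr01// !mulr_ge0.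
exists (d / K); first exact: divr_gt0.
have dK0 := divr_gt0 d0 K0.
have main p q : (forall j, `|p j - q j| < d / K) ->
    value f (share b p i) < value f (share b q i) + e.
  move=> pq; rewrite (@value_setID _ f (share b p i) (share b q i))// ler_ltD//.
    by apply: value_subset => //; exact: pieceI.
  apply: dP; first exact: pieceD.
  apply: (le_lt_trans (len_shareD i (ltW dK0) (fun j => ltW (pq j)))).
  rewrite -[ltRHS](divfK (lt0r_neq0 K0)); move: (d / K) dK0 => r r0.
  rewrite /K; lra.
move=> p q pq; have pq' := main p q pq.
have /main qp j : `|q j - p j| < d / K by rewrite distrC.
by rewrite ltr_norml; apply/andP; split; lra.
Qed.

End shares.

(** * Equalizing market values *)

Section equalization.
Context {R : realType} {N : finType} (b : N -> R -> R) (B C : R).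
Hypothesis bBC : thin_ties b B C.
Hypothesis N_gt0 : (0 < #|N|)%N.
Implicit Types (p q : N -> R) (f : R -> R) (i j h : N) (M : {set N}).

Let pshare p i : piece (share b p i). Proof. by case: bBC. Qed.

Let B0 : 0 <= B.
Proof.
have /card_gt0P[i _] := N_gt0.
have [_ _ _ _ /(_ i i 0)] := bBC.
by rewrite subrr; apply; rewrite /cake/= in_itv/= lexx ler01.
Qed.

(** [M] will be the set of minimizers; only relative weights matter, so this amounts to raising
    [M]. *)
Definition lower M (s : R) p i := if i \in M then p i else p i - s.

Lemma share_lower_in M s p i : 0 <= s -> i \in M ->
  share b p i `<=` share b (lower M s p) i.
Proof.
move=> s0 iM x [cx xi]; split => // j; rewrite /lower iM.
by have := xi j; case: ifP => _; lra.
Qed.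

Lemma share_lower_notin M s p h : 0 <= s -> h \notin M ->
  share b (lower M s p) h `<=` share b p h.
Proof.
move=> s0 /negbTE hM x [cx xh]; split => // j.
by have := xh j; rewrite /lower hM; case: ifP => _; lra.
Qed.

(** Outside [M] all weights drop equally, so nobody there can overtake [h]. *)
Lemma share_lower_lost M s p h x : h \notin M -> share b p h x ->
  ~ share b (lower M s p) h x -> exists2 i, i \in M & share b (lower M s p) i x.
Proof.
move=> /negbTE hM [cx xh] xNh.
have [k _ xk] : (\bigcup_i share b (lower M s p) i) x by rewrite share_cover.
exists k => //; apply: contra_notT xNh => /negbTE kM; split => // j.
have [_ /(_ j)] := xk; have := xh k; rewrite /lower hM kM; lra.
Qed.

(** The loss of [h] has positive length and passes to [M], so some [i] in [M] receives a part of
    positive length; there [v i] is at least [eta], so the gain is strict. *)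
Lemma lower_gain M s p h f (v : N -> R -> R) (eta : R) :
  0 <= s -> h \notin M -> density f -> (forall i, density (v i)) ->
  0 < eta -> (forall i x, cake x -> eta <= v i x) ->
  value f (share b (lower M s p) h) < value f (share b p h) ->
  exists2 i, i \in M &
    value (v i) (share b p i) < value (v i) (share b (lower M s p) i).
Proof.
move=> s0 hM df dv eta0 v_eta hlt; set p' := lower M s p.
set D := share b p h `\` share b p' h.
have pD : piece D by exact: pieceD.
have dl : density (fun=> 1 : R) by exact: density_cst.
have D0 : 0 < len D.
  rewrite lt_neqAle len_ge0// andbT; apply/eqP => D0.
  have := @value_setID _ f (share b p h) (share b p' h) df (pshare _ _) (pshare _ _).
  rewrite (value_null df pD (esym D0)) addr0 setIC => e.
  by move: hlt; rewrite e setIidl ?ltxx//; exact: share_lower_notin.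
have [i iM iD] : exists2 i, i \in M & 0 < len (D `&` share b p' i).
  apply: contrapT => no; move: D0; apply/negP; rewrite -leNgt.
  pose A i := if i \in M then D `&` share b p' i else set0.
  have pA i : piece (A i).
    by rewrite /A; case: ifP => _; [exact: pieceI|exact: piece0].
  apply: (@le_trans _ _ (\sum_i len (A i))).
    apply: ler_value_bigcup => // x [xh xNh].
    have [i iM xi] := share_lower_lost hM xh xNh.
    by exists i => //; rewrite /A iM.
  apply: sumr_le0 => i _; rewrite /A; case: ifP => iM; last first.
    by rewrite /len /value Rintegral_set0.
  by rewrite leNgt; apply/negP => iD; apply: no; exists i.
exists i => //; have hi : h != i by apply: contraNneq hM => ->.
have sub := @share_lower_in M s p i s0 iM.
rewrite (@value_setID _ _ (share b p' i) (share b p i))// (setIidr sub) ltrDl.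
have pG : piece (share b p' i `\` share b p i) by exact: pieceD.
apply: (@lt_le_trans _ _ (eta * len (share b p' i `\` share b p i))); last first.
  rewrite -value_cst//; apply: ler_value => //; first exact/density_cst/ltW.
  by move=> x /pG.2; exact: v_eta.
rewrite mulr_gt0//; apply: (lt_le_trans iD).
have pDi : piece (D `&` share b p' i) by exact: pieceI.
have -> : len (D `&` share b p' i) =
    len (D `&` share b p' i `&` share b p i) +
    len (D `&` share b p' i `\` share b p i) by exact: value_setID.
(* Whatever part of it [i] already held was tied with [h], hence null. *)
have -> : len (D `&` share b p' i `&` share b p i) = 0.
  apply/eqP; rewrite eq_le len_ge0 ?andbT; last exact: pieceI.
  rewrite -(len_shareI bBC p hi); apply: value_subset => //; [exact: pieceI..|].
  by move=> x [[[]]].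
rewrite add0r; apply: value_subset => //; first exact: pieceD.
by move=> x [[]].
Qed.

(** Shift-invariant counterpart of [box]: shares depend on [p] only up to a common shift, and a [p]
    of spread at most [B] can be shifted into [box]. *)
Definition spread p := forall i j, p i - p j <= B.

Definition box : set (prod_topology (fun _ : N => R)) :=
  [set p | forall i, [set` `[0, B]] (p i)].

Lemma box_spread p : box p -> spread p.
Proof.
by move=> pB i j; move: (pB i) (pB j); rewrite /= !in_itv/=; lra.
Qed.

Lemma spread_box p : spread p -> exists2 q, box q & share b q = share b p.
Proof.
move=> sp; have /card_gt0P[i0 _] := N_gt0.
have [j _ jmin] := Order.TotalTheory.arg_minP p (isT : xpredT i0).
exists (fun i => p i + (- p j)); last exact: share_shift.
by move=> i /=; rewrite in_itv/= subr_ge0 (jmin i) ?sp.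
Qed.

Lemma box_compact : compact box.
Proof.
exact: (@tychonoff N (fun=> R) (fun=> [set` `[0, B]])
  (fun=> @segment_compact R 0 B)).
Qed.

Lemma box_nonempty : box !=set0.
Proof. by exists (fun=> 0) => i /=; rewrite in_itv/= lexx. Qed.

Lemma continuous_dist (T : topologicalType) (F : T -> R) :
  (forall x (e : R), 0 < e -> \forall y \near x, `|F x - F y| < e) ->
  continuous F.
Proof. by move=> h x; apply/cvgrPdist_lt => e e0; exact: h. Qed.

Lemma value_share_continuous f i : density f ->
  continuous (fun p : prod_topology (fun _ : N => R) => value f (share b p i)).
Proof.
move=> df; apply: continuous_dist => p e e0.
have [d d0 dP] := value_share_unif bBC i df e0.
have near_p j : \forall q \near p, `|p j - q j| < d.
  have /= := @proj_continuous N (fun=> R) j p.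
  by move/(@pseudometric_normed_Zmodule.cvgr_dist_lt R R^o _ (nbhs p)) => /(_ _ d0).
have := @filter_forall _ N (fun j q => `|p j - q j| < d) _ (nbhs_filter p) near_p.
by apply: (@filterS _ _ (nbhs_filter p)) => q pq; exact: dP.
Qed.

Lemma value_lower_continuous f M p i : density f ->
  continuous (fun s : R => value f (share b (lower M s p) i)).
Proof.
move=> df; apply: continuous_dist => s e e0.
have [d d0 dP] := value_share_unif bBC i df e0.
have : \forall r \near s, `|s - r| < d by exact: nbhsx_ballx.
apply: filterS => r sr; apply: dP => j; rewrite /lower.
case: ifP => _; first by rewrite subrr normr0.
by rewrite [X in `|X|](_ : _ = r - s) 1?distrC//; ring.
Qed.

Lemma continuous_bigmin (T : topologicalType) (c : R) (P : pred N)
    (F : N -> T -> R) : (forall i, continuous (F i)) ->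
  continuous (fun x => \big[Num.min/c]_(i | P i) F i x).
Proof.
move=> cF x; apply: cvg_big => [xy|i _]; last exact: cF.
apply: (@continuous_min _ _ fst snd); [exact: cvg_fst|exact: cvg_snd].
Qed.

Lemma continuous_sum_dist (T : topologicalType) (F : N -> T -> R) :
  (forall i, continuous (F i)) ->
  continuous (fun x => \sum_i \sum_j `|F i x - F j x|).
Proof.
move=> cF x; apply: cvg_big => [|i _]; first exact: add_continuous.
apply: cvg_big => [|j _]; first exact: add_continuous.
by apply: cvg_norm; apply: cvgB; exact: cF.
Qed.

(** A bound common to all agents and weights, used as the default value of finite minima. *)
Lemma value_share_le_total (v : N -> R -> R) p i : (forall i, density (v i)) ->
  value (v i) (share b p i) <= \sum_i value (v i) cake.
Proof.
move=> dv; apply: (@le_trans _ _ (value (v i) cake)).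
  by apply: value_subset => //; [exact: piece_cake|exact: (pshare p i).2].
rewrite (bigD1 i)//= lerDl sumr_ge0// => j _.
by rewrite value_ge0//; exact: piece_cake.
Qed.

(* Lowering the non-minimizers continuously drives their least value from above
   [t] down to 0, so it passes through the midpoint; there some non-minimizer
   has lost a set of positive length, part of which went to a minimizer. *)
Lemma raise_minimizers (v : N -> R -> R) (eta t : R) p :
  (forall i, density (v i)) -> 0 < eta ->
  (forall i x, cake x -> eta <= v i x) ->
  let g p i := value (v i) (share b p i) in
  spread p -> (forall i, t <= g p i) ->
  (exists i, g p i = t) -> (exists i, t < g p i) ->
  exists q, [/\ spread q, forall i, t <= g q i &
    [set i | g q i == t] \proper [set i | g p i == t]]%SET.
Proof.
move=> dv eta0 v_eta g sp gt [k gk] [h0 gh0].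
pose M := [set i | g p i == t]%SET.
have inM i : (i \in M) = (g p i == t) by rewrite inE.
have kM : k \in M by rewrite inM gk.
have h0M : h0 \notin M by rewrite inM gt_eqF.
pose c := \sum_i value (v i) cake.
have gc q i : g q i <= c by exact: value_share_le_total.
pose phi s := \big[Num.min/c]_(h | h \notin M) g (lower M s p) h.
(* As [p] has spread at most [B], lowering by more than [2 * B] puts [h0] more than [B] below [k],
   with an empty share. *)
pose S := 2 * B + 1.
have lower0 : lower M 0 p = p.
  by apply/funext => i; rewrite /lower; case: ifP => //; rewrite subr0.
have phi0 : t < phi 0.
  apply/Order.TotalTheory.bigmin_gtP; split; first exact: lt_le_trans (gc p h0).
  by move=> h hM; rewrite lower0 lt_neqAle gt andbT eq_sym -inM.
have phiS : phi S <= t.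
  apply: (@Order.TotalTheory.bigmin_inf _ _ _ _ h0) => //.
  rewrite /g (@share_far _ _ b B C bBC _ k).
    by rewrite /value Rintegral_set0 -gk value_ge0.
  by rewrite /lower kM (negbTE h0M) /S; have := sp h0 k; lra.
pose tau := (t + phi 0) / 2.
have [s s0S phis] : exists2 s, s \in `[0, S] & phi s = tau.
  apply: IVT; first by rewrite /S; have := B0; lra.
    apply: continuous_subspaceT; apply: continuous_bigmin => h.
    exact: value_lower_continuous.
  by rewrite /tau ge_min le_max; apply/andP; split; apply/orP; [right|left]; lra.
have s0 : 0 <= s by move: s0S; rewrite in_itv/= => /andP[].
have tauL h : h \notin M -> tau <= g (lower M s p) h.
  by move=> hM; rewrite -phis; exact: Order.TotalTheory.bigmin_le_cond.
have t_tau : t < tau by rewrite /tau; lra.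
(* Otherwise no value outside [M] drops and [phi s >= phi 0], whereas [tau < phi 0]. *)
have [h hM hlt] : exists2 h, h \notin M & g (lower M s p) h < g p h.
  apply: contrapT => no; suff : phi 0 <= phi s by rewrite phis /tau; lra.
  apply: Order.TotalTheory.le_bigmin2 => h hM; rewrite lower0 leNgt.
  by apply/negP => hlt; apply: no; exists h.
have [i iM gi] := lower_gain s0 hM (dv h) dv eta0 v_eta hlt.
have gM j : j \in M -> g p j <= g (lower M s p) j.
  by move=> jM; apply: value_subset => //; exact: share_lower_in.
exists (lower M s p); split.
- move=> j l; rewrite /lower; case: ifPn => jM; case: ifPn => lM.
  + exact: sp.
  (* Only this gap widens; beyond [B] the share of [l] would be empty, though its value is at least
     [tau > t >= 0]. *)
  + have := share_far bBC (p := lower M s p) (i := j) (j := l).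
    rewrite /lower jM (negbTE lM) => far; rewrite leNgt; apply/negP => plt.
    have := tauL _ lM; rewrite /g far; last by lra.
    rewrite /value Rintegral_set0 => tau0.
    by have t0 : 0 <= t; [rewrite -gk value_ge0|lra].
  + by have := sp j l; lra.
  + by have := sp j l; lra.
- move=> j; have [jM|jM] := boolP (j \in M); first exact: le_trans (gM j jM).
  exact/ltW/(lt_le_trans t_tau)/tauL.
(* Outside [M] values stay above [t], so no minimizer is new, and [i] ceases to be one. *)
- apply/properP; split.
    apply/fintype.subsetP => j; rewrite !inE => /eqP gj.
    rewrite -inM; apply: contraT => jM.
    by have := tauL j jM; rewrite gj; lra.
  exists i; first by [].
  by rewrite inE gt_eqF//; apply: le_lt_trans gi; exact: gt.
Qed.

(** Start from weights maximizing the least value [t]. While some agent is above [t], the set of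
    agents at [t] can be made strictly smaller; it never becomes empty, since [t] is maximal. So the
    descent ends with all values equal to [t]. *)
Lemma equalize_positive (v : N -> R -> R) (eta : R) :
  (forall i, density (v i)) -> 0 < eta ->
  (forall i x, cake x -> eta <= v i x) ->
  exists2 p, box p & forall i j,
    value (v i) (share b p i) = value (v j) (share b p j).
Proof.
move=> dv eta0 v_eta; pose g p i := value (v i) (share b p i).
have /card_gt0P[i0 _] := N_gt0.
pose c := \sum_i value (v i) cake.
have gc q i : g q i <= c by exact: value_share_le_total.
pose m p := \big[Num.min/c]_i g p i.
have [pm pmB pmax] : exists2 p, p \in box & forall q, q \in box -> m q <= m p.
  apply: compact_EVT_max; [exact: box_nonempty|exact: box_compact|].
  apply: continuous_subspaceT; apply: continuous_bigmin => i.
  exact: value_share_continuous.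
pose t := m pm.
have mle p i : m p <= g p i by exact: Order.TotalTheory.bigmin_le.
have tmax q : spread q -> exists i, g q i <= t.
  move=> /spread_box[r rB rq].
  have [i _ mi] := @Order.TotalTheory.eq_bigmin _ _ _ c i0 xpredT (g r) isT
    (fun i _ => gc r i).
  exists i; rewrite /g -rq -[leLHS]mi; apply: pmax; exact/mem_set.
suff main n : forall p, spread p -> (forall i, t <= g p i) ->
    #|[set i | g p i == t]%SET| = n ->
    exists2 q, spread q & forall i j, g q i = g q j.
  have [||q /spread_box[r rB rq] gq] := main _ pm _ _ erefl.
  - exact/box_spread/set_mem.
  - by move=> i; exact: mle.
  exists r => // i j; rewrite rq; exact: gq.
elim/ltn_ind: n => n IH p sp gt pn.
have [[h gh]|no] := pselect (exists h, t < g p h); last first.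
  exists p => // i j; have e l : g p l = t.
    apply/eqP; rewrite eq_le gt andbT leNgt; apply/negP => tl.
    by apply: no; exists l.
  by rewrite !e.
have [i gi] := tmax p sp.
have gie : g p i = t by apply/eqP; rewrite eq_le gi gt.
have [q [sq gq /proper_card]] := raise_minimizers dv eta0 v_eta sp gt
  (ex_intro _ i gie) (ex_intro _ h gh).
by rewrite pn => qn; exact: IH qn q sq gq erefl.
Qed.

(** The total discrepancy [D] attains its minimum over the compact [box], and equalizing the
    perturbed densities [v i + eta] shows that this minimum is at most any positive [e]. *)
Lemma equalize (v : N -> R -> R) : (forall i, density (v i)) ->
  exists p, forall i j,
    value (v i) (share b p i) = value (v j) (share b p j).
Proof.
move=> dv; pose g p i := value (v i) (share b p i).
pose D (p : prod_topology (fun _ : N => R)) :=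
  \sum_i \sum_j `|g p i - g p j|.
have [p _ pmin] : exists2 p, p \in box & forall q, q \in box -> D p <= D q.
  apply: compact_EVT_min; [exact: box_nonempty|exact: box_compact|].
  apply: continuous_subspaceT; apply: continuous_sum_dist => i.
  exact: value_share_continuous.
suff D0 : D p <= 0.
  exists p => i j; apply/eqP; rewrite -subr_eq0 -normr_le0.
  apply: le_trans D0; rewrite /D (bigD1 i)//= (bigD1 j)//= -addrA lerDl.
  by rewrite addr_ge0 ?sumr_ge0// => k _; rewrite sumr_ge0.
apply/ler_addgt0Pr => e e0; rewrite add0r.
(* Lengths lie in [0, 1], so each of the [#|N| * #|N|] differences in [D q] is at most [eta]. *)
pose eta := e / (#|N|%:R * #|N|%:R).
have NN : 0 < #|N|%:R * #|N|%:R :> R by rewrite mulr_gt0// ltr0n.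
have eta0 : 0 < eta by exact: divr_gt0.
have dc : density (fun=> eta : R) by exact/density_cst/ltW.
have [q qB gq] : exists2 q, box q & forall i j,
    g q i + eta * len (share b q i) = g q j + eta * len (share b q j).
  have [|//||q qB gq] := @equalize_positive (fun i x => v i x + eta) eta.
  - by move=> i; exact: density_add.
  - by move=> i x cx; rewrite lerDr (dv i).1.
  exists q => // i j; have := gq i j.
  by rewrite !value_add// !value_cst.
apply: (le_trans (pmin q (mem_set qB))).
have -> : e = \sum_(i : N) \sum_(j : N) eta.
  by rewrite !sumr_const -mulrnA -[RHS]mulr_natr natrM divfK ?lt0r_neq0.
apply: ler_sum => i _; apply: ler_sum => j _.
have l01 k : 0 <= eta * len (share b q k) <= eta.
  apply/andP; split; first by rewrite mulr_ge0 ?len_ge0 ?(ltW eta0).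
  by rewrite ler_piMr ?len_le1 ?(ltW eta0).
have /andP[li0 li1] := l01 i; have /andP[lj0 lj1] := l01 j.
by have gij := gq i j; rewrite ler_norml; apply/andP; split; lra.
Qed.

End equalization.

(** * Approximate Pareto optimality *)

Section pareto.
Context {R : realType} {N : finType}.
Implicit Types (f : R -> R) (X : set R) (i j : N).

Lemma density_scale (c : R) f : 0 <= c -> density f -> density (fun x => c * f x).
Proof.
move=> c0 df; split=> [x cx|]; first by rewrite mulr_ge0 ?df.1.
have := integrableZl (piece_completed piece_cake) c df.2.
by congr (_.-integrable _ _); apply/funext => x /=; rewrite EFinM.
Qed.

Lemma value_scale (c : R) f X : density f -> piece X ->
  value (fun x => c * f x) X = c * value f X.
Proof.
move=> df pX; apply: RintegralZl; first exact: piece_completed.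
exact: density_integrable.
Qed.

(** On the share of [i], [e^(p i) * u i] is at least [e^(-2 kappa) * e^(p j) * u j] for every [j],
    so no allocation has weighted welfare [S'] above [e^(2 kappa) * S]. An improvement by [eps] for
    everyone would give [eps * W <= S' - S <= 2 * kappa * S' <= 2 * kappa * U * W], contradicting
    [2 * kappa * U < eps]. *)
Lemma share_pareto (u b : N -> R -> R) (B C kappa U eps : R) (p : N -> R) :
  (0 < #|N|)%N -> (forall i, density (u i)) ->
  (forall i x, cake x -> 0 < u i x) -> thin_ties b B C ->
  (forall i x, cake x -> `|b i x - ln (u i x)| <= kappa) ->
  (forall i, value (u i) cake <= U) -> 2 * kappa * U < eps ->
  eps_pareto_optimal u eps (share b p).
Proof.
move=> N0 du u0 bBC bu uU kUe [A' [alA' A'A]].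
have alA := share_allocation bBC p N0; set A := share b p in A'A alA *.
have [pA' _ _] := alA'; have [pA _ _] := alA.
have /card_gt0P[i0 _] := N0.
have k0 : 0 <= kappa.
  by apply: le_trans (bu i0 0 _); rewrite // /cake/= in_itv/= lexx ler01.
pose w i := expR (p i); have w0 i : 0 < w i by exact: expR_gt0.
pose W := \sum_i w i.
have W0 : 0 < W.
  rewrite /W (bigD1 i0)//= ltr_pwDl// sumr_ge0// => i _; exact: ltW.
pose S := \sum_i w i * value (u i) (A i).
pose S' := \sum_i w i * value (u i) (A' i).
have SS' : S + eps * W <= S'.
  rewrite /S /S' /W mulr_sumr -big_split/=; apply: ler_sum => i _.
  by have := A'A i; have := w0 i; nra.
have S'W : S' <= U * W.
  rewrite /S' /W mulr_sumr; apply: ler_sum => i _.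
  rewrite mulrC ler_wpM2r ?(ltW (w0 i))//; apply: le_trans (uU i).
  by apply: value_subset => //; [exact: piece_cake|exact: (pA' i).2].
(* Both sums are refined to the intersections of [A' j] with [A i] and compared termwise through the
   densities. *)
have S'S : S' <= expR (2 * kappa) * S.
  have -> : S' = \sum_j \sum_i w j * value (u j) (A' j `&` A i).
    by apply: eq_bigr => j _; rewrite -mulr_sumr -value_allocation.
  have -> : S = \sum_j \sum_i w i * value (u i) (A' j `&` A i).
    rewrite exchange_big/=; apply: eq_bigr => i _; rewrite -mulr_sumr.
    rewrite (value_allocation (du i) (pA i) alA'); congr (_ * _).
    by apply: eq_bigr => j _; rewrite setIC.
  rewrite mulr_sumr; apply: ler_sum => j _; rewrite mulr_sumr.
  apply: ler_sum => i _; have pX := pieceI (pA' j) (pA i).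
  rewrite mulrA -!value_scale//; apply: ler_value => //.
  - by apply: density_scale => //; exact: ltW.
  - by apply: density_scale => //; rewrite mulr_ge0 ?expR_ge0.
  move=> x [_ [cx /(_ j) xij]].
  rewrite -[u j x]lnK ?posrE ?u0// -[u i x]lnK ?posrE ?u0// -!expRD ler_expR.
  have := bu i x cx; have := bu j x cx; rewrite !ler_norml.
  by move=> /andP[? ?] /andP[? ?]; lra.
have S0 : 0 <= S.
  by apply: sumr_ge0 => i _; rewrite mulr_ge0 ?value_ge0 ?(ltW (w0 i)).
have eS : (1 - 2 * kappa) * S' <= S.
  have e1 := expR_ge1Dx (- (2 * kappa)).
  have S'0 : 0 <= S'.
    by apply: sumr_ge0 => i _; rewrite mulr_ge0 ?value_ge0 ?(ltW (w0 i)).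
  apply: (@le_trans _ _ (expR (- (2 * kappa)) * S')); first exact: ler_wpM2r.
  by rewrite expRN ler_pdivrMl ?expR_gt0.
have : 2 * kappa * S' <= 2 * kappa * (U * W) by rewrite ler_wpM2l// mulr_ge0.
by nra.
Qed.

End pareto.

(** * Lipschitz continuity of log densities *)

Section potentials.
Context {R : realType}.
Implicit Types (f : R -> R) (x y : R).

Lemma lipschitz_densityP f : lipschitz_density f -> exists2 K, 0 <= K &
  forall x y, cake x -> cake y -> `|f x - f y| <= K * `|x - y|.
Proof.
move=> [K fK]; exists `|K| => // x y cx cy.
apply: le_trans (fK (x, y) (conj cx cy)) _.
by apply: ler_wpM2r => //; exact: ler_norm.
Qed.

Lemma lipschitz_density_bounded_below f : lipschitz_density f ->
  (forall x, cake x -> 0 < f x) ->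
  exists2 c : R, 0 < c & forall x, cake x -> c <= f x.
Proof.
move=> /lipschitz_densityP[K K0 fK] f0.
have cf : {within `[0, 1], continuous f}.
  apply/subspace_continuousP => x cx; apply/cvgrPdist_lt => e e0.
  have d0 : 0 < e / (K + 1) by rewrite divr_gt0// ltr_wpDl.
  apply: filterS (nbhsx_ballx x _ d0) => y xy cy.
  apply: le_lt_trans (fK x y cx cy) _.
  move: xy; rewrite /ball/= => xy.
  have K1 : K + 1 != 0 by rewrite gt_eqF// ltr_wpDl.
  rewrite -(divfK K1 e); move: (e / (K + 1)) d0 xy => d d0 xy.
  by have := normr_ge0 (x - y); nra.
have [x xc xmin] := EVT_min ler01 cf.
by exists (f x) => [|y yc]; [exact: f0|exact: xmin].
Qed.

(** By [ln (1 + z) <= z], [ln (f x / f y)] is at most [(f x - f y) / f y], and [f y] is bounded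
    below by a positive [c]. *)
Lemma ln_lipschitz f : lipschitz_density f ->
  (forall x, cake x -> 0 < f x) -> exists2 L, 0 <= L &
  forall x y, cake x -> cake y -> `|ln (f x) - ln (f y)| <= L * `|x - y|.
Proof.
move=> lf f0; have [K K0 fK] := lipschitz_densityP lf.
have [c c0 cf] := lipschitz_density_bounded_below lf f0.
have half x y : cake x -> cake y -> ln (f x) - ln (f y) <= K / c * `|x - y|.
  move=> cx cy; have fx := f0 x cx; have fy := f0 y cy.
  rewrite -ln_div ?posrE//.
  have -> : f x / f y = 1 + (f x / f y - 1) by ring.
  apply: (@le_trans _ _ (f x / f y - 1)).
    by apply: le_ln1Dx; rewrite ltrBrDr addNr divr_gt0.
  have -> : f x / f y - 1 = (f x - f y) / f y by rewrite mulrBl divff ?gt_eqF.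
  apply: (@le_trans _ _ (K * `|x - y| / f y)).
    rewrite ler_pM2r ?invr_gt0//; apply: le_trans (fK x y cx cy).
    exact: ler_norm.
  rewrite mulrAC ler_wpM2r// ler_wpM2l// lef_pV2 ?posrE//; exact: cf.
exists (K / c) => [|x y cx cy]; first by rewrite divr_ge0// ltW.
rewrite ler_norml lerNl opprB half//= distrC half//.
Qed.

End potentials.

(** * Potentials approximating log densities *)

Section step_potentials.
Context {R : realType} {N : finType} (m : nat) (delta : R) (a : N -> nat -> R).
Hypotheses (m_gt0 : (0 < m)%N) (delta_gt0 : 0 < delta).
Implicit Types (x y : R) (i j : N).

Let m0 : 0 < m%:R :> R. Proof. by rewrite ltr0n. Qed.

(** Index of the interval of length [1 / m] containing [x]; the point 1 has index [m], so the cake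
    meets [m + 1] cells. *)
Definition cell x : nat := Num.truncn (x * m%:R).

(** A step function plus a linear tilt; distinct slopes keep the difference of two potentials from
    being constant on a cell. *)
Definition tilted i x : R := a i (cell x) + delta * (enum_rank i)%:R * x.

Lemma cell_le x : cake x -> (cell x <= m)%N.
Proof.
rewrite /cake/= in_itv/= => /andP[x0 x1].
rewrite /cell truncn_le_nat -natr1; apply: (@le_lt_trans _ _ m%:R).
  by rewrite ler_piMl.
by rewrite ltrDl.
Qed.

Lemma measurable_cell (k : nat) :
  measurable (cake `&` [set x : measurableTypeR R | cell x = k]).
Proof.
rewrite (_ : _ `&` _ = cake `&` [set` `[k%:R / m%:R, k.+1%:R / m%:R[]).
  by apply: measurableI; exact: measurable_itv.
apply/seteqP; split => x [cx /= xk]; split => //; move: cx xk;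
  rewrite /cake/= !in_itv/= => /andP[x0 x1].
- move=> <-; rewrite ler_pdivrMr// ltr_pdivlMr//.
  by apply: truncn_itv; rewrite mulr_ge0.
- by rewrite ler_pdivrMr// ltr_pdivlMr// => /truncn_def.
Qed.

Lemma measurable_tilted i :
  measurable_fun cake (tilted i : measurableTypeR R -> measurableTypeR R).
Proof.
apply: measurable_funD.
  apply: (@measurable_comp _ _ _ _ _ _ setT) => //.
  move=> _ Y _.
  rewrite (_ : _ `&` _ =
      \bigcup_(k in Y) (cake `&` [set x : R | cell x = k])).
    by apply: bigcup_measurable => k _; exact: measurable_cell.
  apply/seteqP; split=> [x [cx Yx]|x [k Yk [cx /= xk]]]; first by exists (cell x).
  by split => //=; rewrite xk.
by apply: measurable_funM.
Qed.

Let measurable_ge i j (s : R) :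
  piece [set x | cake x /\ s + tilted j x <= tilted i x].
Proof.
split=> [|x []//].
apply: (@measurable_fun_le _ (measurableTypeR R) R cake).
- exact: piece_cake.1.
- by apply: measurable_funD => //; exact: measurable_tilted.
- exact: measurable_tilted.
Qed.

Lemma piece_share p i : piece (share tilted p i).
Proof.
split=> [|x []//].
rewrite (_ : share _ _ _ = cake `&`
    \bigcap_j [set x | cake x /\ (p j - p i) + tilted j x <= tilted i x]).
  apply: measurableI; first exact: piece_cake.1.
  by apply: fin_bigcap_measurable => // j _; exact: (measurable_ge _ _ _).1.
apply/seteqP; split=> x [cx xi]; split => // j.
- by move=> _; split => //; have := xi j; lra.
- by have [_] := xi j I; lra.
Qed.

Lemma piece_strip i j (s d : R) : piece (strip tilted i j s d).
Proof.
rewrite (_ : strip _ _ _ _ _ =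
    [set x | cake x /\ (s - d) + tilted j x <= tilted i x] `&`
    [set x | cake x /\ (- s - d) + tilted i x <= tilted j x]).
  by apply: pieceI; exact: measurable_ge.
apply/seteqP; split=> [x [cx]|x [[cx ?] [_ ?]]].
  by rewrite ler_norml => /andP[? ?]; split; split => //; lra.
by split => //; rewrite ler_norml; apply/andP; split; lra.
Qed.

(* On one cell [tilted i - tilted j] is affine with slope at least [delta] in
   absolute value, since the ranks of [i] and [j] are distinct naturals. *)
Lemma len_strip_cell i j (s d : R) (k : nat) : i != j -> 0 <= d ->
  len (strip tilted i j s d `&` [set x | cake x /\ cell x = k]) <=
  4 / delta * d.
Proof.
move=> ij d0; set X := _ `&` _.
have pX : piece X.
  apply: pieceI; first exact: piece_strip.
  by split=> [|x []//]; exact: measurable_cell.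
have r0 : 0 <= 2 * d / delta by rewrite divr_ge0 ?mulr_ge0// ltW.
have -> : 4 / delta * d = 4 * d / delta by rewrite mulrAC.
have [[x0 [[cx0 x0s] [_ x0k]]]|X0] := pselect (X !=set0); last first.
  have -> : X = set0 by apply/seteqP; split=> // x Xx; apply: X0; exists x.
  by rewrite /len /value Rintegral_set0 divr_ge0 ?mulr_ge0// ltW.
(* Values in the strip differ by at most [2 * d], so slope at least [delta] keeps its points in the
   cell within [2 * d / delta] of [x0]. *)
pose r := 2 * d / delta.
have -> : 4 * d / delta = (x0 + r) - (x0 - r) by rewrite /r; field; rewrite gt_eqF.
apply: len_interval => //; first by rewrite /r; lra.
move=> x [[cx xs] [_ xk]]; rewrite /= in_itv/= -ler_distl.
have dr : delta * r = 2 * d by rewrite /r; field; rewrite gt_eqF.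
pose e : R := (enum_rank i)%:R - (enum_rank j)%:R.
have e1 : 1 <= `|e|.
  have nij : (enum_rank i : nat) != enum_rank j.
    by apply: contra ij => /eqP /val_inj /enum_rank_inj ->.
  rewrite /e; case: ltngtP nij => // + _; rewrite -(ler_nat R) -natr1 => h.
    by rewrite ler0_norm; lra.
  by rewrite ger0_norm; lra.
have : `|delta * e * (x - x0)| <= 2 * d.
  have -> : delta * e * (x - x0) =
      (tilted i x - tilted j x - s) - (tilted i x0 - tilted j x0 - s).
    by rewrite /tilted xk x0k /e; ring.
  apply: le_trans (ler_normB _ _) _; lra.
rewrite !normrM (gtr0_norm delta_gt0) -dr -mulrA ler_pM2l//; apply: le_trans.
by rewrite ler_peMl.
Qed.

(** The strip bound for one cell is summed over the [m + 1] cells. *)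
Lemma thin_ties_tilted : exists B C, thin_ties tilted B C.
Proof.
pose a1 := \sum_i \sum_(k < m.+1) `|a i k|.
(* Each step value is at most [a1] in absolute value, and the tilts lie between 0 and
   [delta * #|N|]. *)
pose B := 2 * a1 + delta * #|N|%:R.
exists B, (m.+1%:R * (4 / delta)); split.
- by rewrite mulr_ge0// divr_ge0// ltW.
- exact: piece_share.
- exact: piece_strip.
- move=> i j s d ij d0.
  pose A (k : 'I_m.+1) :=
    strip tilted i j s d `&` [set x | cake x /\ cell x = k].
  have pA k : piece (A k).
    apply: pieceI; first exact: piece_strip.
    by split=> [|x []//]; exact: measurable_cell.
  apply: (@le_trans _ _ (\sum_k len (A k))).
    apply: ler_value_bigcup => //; first exact: density_cst.
      exact: piece_strip.
    move=> x xs; have cx := xs.1.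
    by exists (Ordinal (cell_le cx : cell x < m.+1)%N).
  have -> : m.+1%:R * (4 / delta) * d = \sum_(k < m.+1) 4 / delta * d.
    by rewrite sumr_const card_ord -mulrA mulr_natl.
  by apply: ler_sum => k _; exact: len_strip_cell.
- move=> i j x cx.
  have a_le l : `|a l (cell x)| <= a1.
    rewrite /a1 (bigD1 l)//= (bigD1 (Ordinal (cell_le cx : cell x < m.+1)%N))//=.
    rewrite -addrA lerDl addr_ge0// sumr_ge0// => *; exact: sumr_ge0.
  have [x0 x1] : 0 <= x /\ x <= 1.
    by move: cx; rewrite /cake/= in_itv/= => /andP[].
  have r_le (l : N) : 0 <= delta * (enum_rank l)%:R * x <= delta * #|N|%:R.
    have dl : 0 <= delta * (enum_rank l)%:R by rewrite mulr_ge0// ltW.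
    rewrite mulr_ge0//=; apply: (@le_trans _ _ (delta * (enum_rank l)%:R)).
      by rewrite ler_piMr.
    by rewrite ler_pM2l// ler_nat; exact: ltnW (ltn_ord _).
  have := a_le i; have := a_le j; rewrite !ler_norml => /andP[? ?] /andP[? ?].
  have /andP[? ?] := r_le i; have /andP[? ?] := r_le j.
  by rewrite /tilted /B; lra.
Qed.

End step_potentials.

(** [ln (u i)] is sampled at the left ends of the cells and then tilted; sampling and tilting each
    cost at most [kappa / 2]. *)
Lemma ln_potentials (R : realType) (N : finType) (u : N -> R -> R) (kappa : R) :
  (0 < #|N|)%N -> (forall i, lipschitz_density (u i)) ->
  (forall i x, cake x -> 0 < u i x) -> 0 < kappa ->
  exists b B C, thin_ties b B C /\
    forall i x, cake x -> `|b i x - ln (u i x)| <= kappa.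
Proof.
move=> N0 lu u0 k0.
have /choice[L /= LP] : forall i, exists L, 0 <= L /\
    forall x y, cake x -> cake y -> `|ln (u i x) - ln (u i y)| <= L * `|x - y|.
  by move=> i; have [L L0 LP] := ln_lipschitz (lu i) (u0 i); exists L.
pose L1 := \sum_i L i.
have L10 : 0 <= L1 by apply: sumr_ge0 => i _; exact: (LP i).1.
have LL1 i : L i <= L1.
  by rewrite /L1 (bigD1 i)//= lerDl sumr_ge0// => j _; exact: (LP j).1.
(* Cells so fine that functions with the common Lipschitz constant [L1] vary by at most [kappa / 2]
   on each. *)
pose m := (Num.truncn (2 * L1 / kappa)).+1.
have m0 : (0 < m%:R :> R) by rewrite ltr0n.
have Lm : L1 / m%:R <= kappa / 2.
  have /andP[_ h] : (Num.truncn (2 * L1 / kappa))%:R <= 2 * L1 / kappa < m%:R.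
    by apply: truncn_itv; rewrite divr_ge0 ?mulr_ge0// ltW.
  rewrite ler_pdivrMr//; move: h; rewrite ltr_pdivrMr//; lra.
have n0 : (0 < #|N|%:R :> R) by rewrite ltr0n.
(* Ranks are below [#|N|], so each tilt is at most [kappa / 2] on the cake. *)
pose delta := kappa / 2 / #|N|%:R.
have d0 : 0 < delta by rewrite !divr_gt0.
pose a i (k : nat) := ln (u i (k%:R / m%:R)).
have [B [C BC]] := @thin_ties_tilted R N m delta a isT d0.
exists (tilted m delta a), B, C; split => // i x cx.
have [x0 x1] : 0 <= x /\ x <= 1.
  by move: cx; rewrite /cake/= in_itv/= => /andP[].
have /andP[c1 c2] : (cell m x)%:R <= x * m%:R < (cell m x).+1%:R.
  by apply: truncn_itv; rewrite mulr_ge0// ltW.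
pose y : R := (cell m x)%:R / m%:R.
have yx : y <= x by rewrite /y ler_pdivrMr.
have xy : x <= y + 1 / m%:R.
  by rewrite /y -mulrDl natr1 ler_pdivlMr// ltW.
have y0 : 0 <= y by rewrite /y divr_ge0// ltW.
have cy : cake y by rewrite /cake/= in_itv/= y0 (le_trans yx).
have h1 : `|ln (u i y) - ln (u i x)| <= kappa / 2.
  apply: le_trans ((LP i).2 _ _ cy cx) _; apply: le_trans Lm.
  apply: ler_pM => //; first exact: (LP i).1.
  by rewrite ler0_norm; lra.
have h2 : 0 <= delta * (enum_rank i)%:R * x <= kappa / 2.
  have dl : 0 <= delta * (enum_rank i)%:R by rewrite mulr_ge0// ltW.
  rewrite mulr_ge0//=; apply: (@le_trans _ _ (delta * (enum_rank i)%:R)).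
    by rewrite ler_piMr.
  have -> : kappa / 2 = delta * #|N|%:R by rewrite /delta divfK// gt_eqF.
  by rewrite ler_pM2l// ler_nat; exact: ltnW (ltn_ord _).
rewrite /tilted /a -/y; move: h1 h2; rewrite !ler_norml.
by move=> /andP[? ?] /andP[? ?]; apply/andP; split; lra.
Qed.

Theorem theorem14 (R : realType) (N : finType) (N_gt0 : (0 < #|N|)%N)
    (u v : N -> R -> R)
    (u_density : forall i, density (u i))
    (u_pos : forall i x, cake x -> 0 < u i x)
    (u_lip : forall i, lipschitz_density (u i))
    (v_density : forall i, density (v i))
    (eps : R) (eps_gt0 : 0 < eps) :
  exists A : N -> set R,
    [/\ allocation A, eps_pareto_optimal u eps A & equitable v A].
Proof.
pose U := \sum_i value (u i) cake + 1.
have U0 : 0 < U.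
  rewrite ltr_wpDl// sumr_ge0// => i _; rewrite value_ge0//; exact: piece_cake.
have uU i : value (u i) cake <= U.
  rewrite /U (bigD1 i)//= -addrA lerDl addr_ge0// sumr_ge0// => j _.
  by rewrite value_ge0//; exact: piece_cake.
(* Chosen so that [2 * kappa * U = eps / 2]. *)
pose kappa := eps / (4 * U).
have k0 : 0 < kappa by rewrite divr_gt0// mulr_gt0.
have [b [B [C [bBC bu]]]] := ln_potentials N_gt0 u_lip u_pos k0.
have [p pv] := equalize bBC N_gt0 v_density.
exists (share b p); split => //; first exact: share_allocation bBC _ _.
apply: (share_pareto _ u_density u_pos bBC bu uU) => //.
have -> : 2 * kappa * U = eps / 2 by rewrite /kappa; field; rewrite gt_eqF.
lra.
Qed.
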